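(* Let $X\subseteq\{\mathbf{D},\mathbf{T},\mathbf{4}\}$. Every formula derivable in $\mathbf{LIK}X$ is valid in the class $\mathcal{C}^X_{\mathbf{fdc}}$, i.e. forced at every world of every model based on a forward and downward confluent $X$-frame.
   Context: Formulas are built from atoms by $A::=p\mid A\supset A\mid \top\mid\bot\mid A\vee A\mid A\wedge A\mid \square A\mid \lozenge A$; $\neg A$ abbreviates $A\supset\bot$. $\mathbf{LIK}X$: axioms of intuitionistic propositional logic, $(\mathbf{K}_\square)\ \square(p\supset q)\supset(\square p\supset\square q)$, $(\mathbf{K}_\lozenge)\ \square(p\supset q)\supset(\lozenge p\supset\lozenge q)$, $(\mathbf{DP})\ \lozenge(p\vee q)\supset\lozenge p\vee\lozenge q$, $(\mathbf{RV})\ \square(p\vee q)\supset\lozenge p\vee\square q$, $(\mathbf{N})\ \neg\lozenge\bot$, plus $(\mathbf{D})\ \lozenge\top$ if $\mathbf{D}\in X$, $(\mathbf{T})\ (\square p\supset p)\wedge(p\supset\lozenge p)$ if $\mathbf{T}\in X$, $(\mathbf{4})\ (\square p\supset\square\square p)\wedge(\lozenge\lozenge p\supset\lozenge p)$ if $\mathbf{4}\in X$ (with substitution instances), closed under modus ponens and necessitation (from $A$ infer $\square A$). A frame $(W,\leq,R)$: $W\neq\emptyset$, $\leq$ a preorder, $R$ binary relation. Forward confluent: $x\leq x'$ and $Rxy$ imply some $y'$ with $Rx'y'$, $y\leq y'$. Downward confluent: $x\leq x'$ and $Rx'y$ imply some $z$ with $Rxz$, $z\leq y$. An $X$-frame has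 $R$ serial if $\mathbf{D}\in X$, reflexive if $\mathbf{T}\in X$, transitive if $\mathbf{4}\in X$. A model adds $V:\mathbf{At}\to\wp(W)$ with $\leq$-upward closed values. Forcing: $x\Vdash p$ iff $x\in V(p)$; $\top,\bot,\wedge,\vee$ pointwise; $x\Vdash A\supset B$ iff for all $x'\geq x$, $x'\Vdash A$ implies $x'\Vdash B$; $x\Vdash\square A$ iff $y\Vdash A$ for all $y$ with $Rxy$; $x\Vdash\lozenge A$ iff $y\Vdash A$ for some $y$ with $Rxy$. *)

(* Defs.v *)
Set Implicit Arguments.

Inductive formula (At : Type) : Type :=
| Atom : At -> formula At
| Imp : formula At -> formula At -> formula At
| Top : formula At
| Bot : formula At
| Or : formula At -> formula At -> formula At
| And : formula At -> formula At -> formula At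
| Box : formula At -> formula At
| Dia : formula At -> formula At.

Arguments Top {At}.
Arguments Bot {At}.

Definition Neg (At : Type) (A : formula At) : formula At := Imp A Bot.

Declare Scope lik_scope.
Delimit Scope lik_scope with lik.
Bind Scope lik_scope with formula.
Infix "⊃" := Imp (at level 70, right associativity) : lik_scope.
Infix "∨" := Or (at level 60, right associativity) : lik_scope.
Infix "∧" := And (at level 58, right associativity) : lik_scope.
Notation "⊤" := Top : lik_scope.
Notation "⊥" := Bot : lik_scope.
Notation "¬ A" := (Neg A) (at level 50, A at level 50) : lik_scope.
Notation "□ A" := (Box A) (at level 50, A at level 50) : lik_scope.
Notation "◇ A" := (Dia A) (at level 50, A at level 50) : lik_scope.
Local Open Scope lik_scope.

Inductive extra_axiom : Set := axD | axT | ax4.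

(* A subset X of {D, T, 4}. *)
Definition extra_axioms : Type := extra_axiom -> Prop.

(* Axioms are schemes over formulas: each constructor stands for all the
   substitution instances of the corresponding axiom on atoms p, q.
   This is a standard Hilbert axiomatization of intuitionistic propositional
   logic, with modus ponens as its rule. *)
Inductive ipl_axiom (At : Type) : formula At -> Prop :=
| ipl_K A B : ipl_axiom (A ⊃ B ⊃ A)
| ipl_S A B C : ipl_axiom ((A ⊃ B ⊃ C) ⊃ (A ⊃ B) ⊃ A ⊃ C)
| ipl_and_l A B : ipl_axiom (A ∧ B ⊃ A)
| ipl_and_r A B : ipl_axiom (A ∧ B ⊃ B)
| ipl_and_i A B : ipl_axiom (A ⊃ B ⊃ A ∧ B)
| ipl_or_l A B : ipl_axiom (A ⊃ A ∨ B)
| ipl_or_r A B : ipl_axiom (B ⊃ A ∨ B)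
| ipl_or_e A B C : ipl_axiom ((A ⊃ C) ⊃ (B ⊃ C) ⊃ A ∨ B ⊃ C)
| ipl_top : ipl_axiom ⊤
| ipl_bot A : ipl_axiom (⊥ ⊃ A).

Inductive modal_axiom (At : Type) (X : extra_axioms) : formula At -> Prop :=
| modal_KBox A B : modal_axiom X (□ (A ⊃ B) ⊃ (□ A ⊃ □ B))
| modal_KDia A B : modal_axiom X (□ (A ⊃ B) ⊃ (◇ A ⊃ ◇ B))
| modal_DP A B : modal_axiom X (◇ (A ∨ B) ⊃ (◇ A ∨ ◇ B))
| modal_RV A B : modal_axiom X (□ (A ∨ B) ⊃ (◇ A ∨ □ B))
| modal_N : modal_axiom X (¬ (◇ ⊥))
| modal_D : X axD -> modal_axiom X (◇ ⊤)
| modal_T A : X axT -> modal_axiom X ((□ A ⊃ A) ∧ (A ⊃ ◇ A))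
| modal_4 A : X ax4 -> modal_axiom X ((□ A ⊃ □ (□ A)) ∧ (◇ (◇ A) ⊃ ◇ A)).

Inductive LIK (At : Type) (X : extra_axioms) : formula At -> Prop :=
| LIK_ipl A : ipl_axiom A -> LIK X A
| LIK_modal A : modal_axiom X A -> LIK X A
| LIK_mp A B : LIK X (A ⊃ B) -> LIK X A -> LIK X B
| LIK_nec A : LIK X A -> LIK X (□ A).

Record frame : Type := Frame {
  world :> Type;
  world_nonempty : inhabited world;
  le : world -> world -> Prop;
  le_refl : forall x, le x x;
  le_trans : forall x y z, le x y -> le y z -> le x z;
  acc : world -> world -> Prop
}.

Definition forward_confluent (F : frame) : Prop :=
  forall x x' y : F, le F x x' -> acc F x y ->
    exists y' : F, acc F x' y' /\ le F y y'.

Definition downward_confluent (F : frame) : Prop :=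
  forall x x' y : F, le F x x' -> acc F x' y ->
    exists z : F, acc F x z /\ le F z y.

Definition serial (F : frame) : Prop := forall x : F, exists y : F, acc F x y.

Definition reflexive (F : frame) : Prop := forall x : F, acc F x x.

Definition transitive (F : frame) : Prop :=
  forall x y z : F, acc F x y -> acc F y z -> acc F x z.

Definition X_frame (X : extra_axioms) (F : frame) : Prop :=
  (X axD -> serial F) /\ (X axT -> reflexive F) /\ (X ax4 -> transitive F).

Definition C_fdc (X : extra_axioms) (F : frame) : Prop :=
  X_frame X F /\ forward_confluent F /\ downward_confluent F.

Record model (At : Type) : Type := Model {
  model_frame :> frame;
  val : At -> model_frame -> Prop;
  val_up : forall p (x y : model_frame),
    le model_frame x y -> val p x -> val p y
}.

Fixpoint forces (At : Type) (M : model At) (x : M) (A : formula At) : Prop :=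
  match A with
  | Atom p => val M p x
  | Imp A B => forall x' : M, le M x x' -> forces M x' A -> forces M x' B
  | Top => True
  | Bot => False
  | Or A B => forces M x A \/ forces M x B
  | And A B => forces M x A /\ forces M x B
  | Box A => forall y : M, acc M x y -> forces M y A
  | Dia A => exists y : M, acc M x y /\ forces M y A
  end.

Definition valid_in_class (At : Type) (C : frame -> Prop) (A : formula At) : Prop :=
  forall M : model At, C M -> forall x : M, forces M x A.

(* Main.v *)
(** Soundness by induction on derivations. Forcing persists along the preorder:
    downward confluence carries boxes upward, forward confluence carries
    diamonds upward. With persistence, every axiom holds by unfolding the
    forcing clauses; RV needs excluded middle, to decide whether some
    accessible world forces the first disjunct. *)

From Stdlib Require Import Classical.
Require Import Defs.

Set Implicit Arguments.

Lemma forces_mono (At : Type) (M : model At) :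
  forward_confluent M -> downward_confluent M ->
  forall (A : formula At) (x y : M),
    le M x y -> forces M x A -> forces M y A.
Proof.
  intros fc dc A.
  induction A as [p|A IHA B IHB| | |A IHA B IHB|A IHA B IHB|A IHA|A IHA];
    simpl; intros x y xy H.
  - exact (val_up M p x y xy H).
  - intros z yz. apply H. exact (le_trans M _ _ _ xy yz).
  - exact I.
  - exact H.
  - destruct H as [H|H]; [left|right]; eauto.
  - destruct H; split; eauto.
  - intros v yv. destruct (dc _ _ _ xy yv) as [u [xu uv]]. eauto.
  - destruct H as [u [xu Hu]].
    destruct (fc _ _ _ xy xu) as [v [yv uv]]. eauto.
Qed.

(** Premises get reused at later worlds: persistence allows this in [ipl_K] and [ipl_and_i],
    transitivity of the preorder in [ipl_S] and [ipl_or_e]. *)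
Lemma ipl_axiom_forced (At : Type) (M : model At) (A : formula At) :
  forward_confluent M -> downward_confluent M ->
  ipl_axiom A -> forall x : M, forces M x A.
Proof.
  intros fc dc HA. pose proof (forces_mono M fc dc) as mono.
  pose proof (le_refl M) as refl. pose proof (le_trans M) as trans.
  destruct HA; simpl; intros x; try tauto.
  - eauto.
  - intros y _ HABC z yz HAB w zw HA. apply (HABC w); eauto.
  - intros y _ HA z yz HB. split; eauto.
  - intros y _ HAC z yz HBC w zw [HA|HB]; eauto.
Qed.

Lemma modal_axiom_forced (At : Type) (X : extra_axioms) (M : model At)
    (A : formula At) :
  C_fdc X M -> modal_axiom X A -> forall x : M, forces M x A.
Proof.
  intros [[ser [refl trans]] [fc dc]] HA.
  pose proof (le_refl M) as le_refl.
  destruct HA as [A B|A B|A B|A B| |HX|A HX|A HX]; simpl; intros x.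
  - intros y _ HAB z yz HA w zw.
    (* The boxed implication is given at [y], but [□ A] only at [z] above it. Persistence moves the
       former to [z]; the implication is then applied at [w] itself. *)
    exact (forces_mono M fc dc (Box (Imp A B)) y z yz HAB w zw w
             (le_refl w) (HA w zw)).
  - intros y _ HAB z yz [w [zw HA]]. exists w. split; [exact zw|].
    exact (forces_mono M fc dc (Box (Imp A B)) y z yz HAB w zw w
             (le_refl w) HA).
  - intros y _ [w [yw [H|H]]]; eauto.
  - intros y _ HAB.
    destruct (classic (exists w : M, acc M y w /\ forces M w A)) as [H|H].
    + left. exact H.
    + right. intros w yw. destruct (HAB w yw) as [HA|HB]; [|exact HB].
      destruct H. eauto.
  - intros y _ [w [_ []]].
  - destruct (ser HX x) as [y xy]. eauto.
  - split; intros y _ H.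
    + exact (H y (refl HX y)).
    + exact (ex_intro _ y (conj (refl HX y) H)).
  - split.
    + intros y _ H z yz w zw. exact (H w (trans HX _ _ _ yz zw)).
    + intros y _ [z [yz [w [zw H]]]]. exists w. split; [|exact H].
      exact (trans HX _ _ _ yz zw).
Qed.

Theorem theorem1 (At : Type) (X : extra_axioms) (A : formula At) :
  LIK X A -> valid_in_class (C_fdc X) A.
Proof.
  intros HA M HM.
  (* The model is fixed but the world is not: necessitation needs the induction hypothesis at a
     successor. *)
  induction HA as [A HA|A HA|A B _ IHAB _ IHA|A _ IHA].
  - destruct HM as [_ [fc dc]]. exact (ipl_axiom_forced M fc dc HA).
  - exact (modal_axiom_forced M HM HA).
  - intros x. exact (IHAB x x (le_refl M x) (IHA x)).
  - intros x y _. exact (IHA y).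
Qed.
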